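(* Let $\mu$ be a locally finite Borel measure on $\mathbb{R}^n$ and let $0\le\alpha<n$. Then the following are equivalent: (1) there exists $x_0\in\mathbb{R}^n$ such that $(\mathrm{M}_\alpha\mu)(x_0)<\infty$; (2) $\mathrm{M}_\alpha\mu<\infty$ $\mathcal{H}^{n-\alpha}$-almost everywhere, that is, $\mathcal{H}^{n-\alpha}\big(\{x\in\mathbb{R}^n:(\mathrm{M}_\alpha\mu)(x)=\infty\}\big)=0$.
   Context: A locally finite Borel measure on $\mathbb{R}^n$ is a positive Borel measure $\mu$ with $\mu(K)<\infty$ for every compact $K$. $\mathcal{L}$ denotes Lebesgue measure and $B_r(x)$ the Euclidean ball. For $0\le\alpha<n$, $\mathrm{M}_\alpha\mu(x)=\sup_{r>0} r^\alpha\,\mu(B_r(x))/\mathcal{L}(B_r(x))\in[0,\infty]$. Hausdorff measure: for $s\ge0$ and $0<\delta\le\infty$, $\mathcal{H}^s_\delta(E)=\inf\{\sum_k \ell(Q_k)^s: E\subseteq\bigcup_k Q_k,\ \ell(Q_k)\le\delta\}$, the infimum being over countable coverings of $E$ by cubes $Q_k$ with side length $\ell(Q_k)\le\delta$; and $\mathcal{H}^s(E)=\sup_{\delta>0}\mathcal{H}^s_\delta(E)$. (This is comparable to the usual Hausdorff measure up to a constant depending on $n,s$.) *)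

(* Defs.v *)
From HB Require Import structures.
From mathcomp Require Import all_boot all_order all_algebra.
From mathcomp Require Import all_classical all_reals all_analysis.

Set Implicit Arguments.
Unset Strict Implicit.
Unset Printing Implicit Defensive.

Import Order.TTheory GRing.Theory Num.Theory.
Import numFieldNormedType.Exports.

Local Open Scope classical_set_scope.
Local Open Scope ring_scope.

(* The topology of 'rV[R]_n is that of the sup norm, i.e. the Euclidean one. *)
Notation borel_space R n := (g_sigma_algebraType (open : set (set 'rV[R]_n))).

Definition locally_finite (R : realType) (n : nat)
    (mu : {measure set (borel_space R n) -> \bar R}) : Prop :=
  forall K : set 'rV[R]_n, compact K -> (mu K < +oo)%E.

Definition pushforward_measure d1 d2 (T1 : measurableType d1)
    (T2 : measurableType d2) (R : realType) (m : {measure set T1 -> \bar R})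
    (f : T1 -> T2) (mf : measurable_fun setT f) :
    {measure set T2 -> \bar R} :=
  measure_function_pushforward__canonical__measure_function_Measure m mf.

(* The n-fold product of the Lebesgue measure of the line, by recursion on n.
   Being a product, it lives on the product sigma-algebra of n.-tuple R; it is
   then transported to the Borel sets of 'rV[R]_n along the coordinates. *)
Section lebesgue_step.
Context (R : realType) (n : nat).
Let RT := measurableTypeR R.
Variable m : {sigma_finite_measure set (n.-tuple RT) -> \bar R}.

Definition pair_cons (p : RT * n.-tuple RT) : n.+1.-tuple RT :=
  [the n.+1.-tuple RT of p.1 :: p.2].

Lemma measurable_pair_cons : measurable_fun setT pair_cons.
Proof. exact: measurable_cons. Qed.

Definition lebesgue_step : set (n.+1.-tuple RT) -> \bar R :=
  pushforward (@lebesgue_measure R \x m)%E pair_cons.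

HB.instance Definition _ := Measure.copy lebesgue_step
  (pushforward_measure (@lebesgue_measure R \x m)%E measurable_pair_cons).

Let lebesgue_step_sigma_finite : sigma_finite setT lebesgue_step.
Proof.
have /sigma_finiteP[F [UF ndF mF]] := sigma_finiteT (@lebesgue_measure R).
have /sigma_finiteP[G [UG ndG mG]] := sigma_finiteT m.
pose head (t : n.+1.-tuple RT) : RT := tnth t ord0.
pose tail (t : n.+1.-tuple RT) : n.-tuple RT := [tuple of behead t].
have Hcons k : pair_cons @^-1` (head @^-1` F k `&` tail @^-1` G k) = F k `*` G k.
  have tailK (p : RT * n.-tuple RT) : tail (pair_cons p) = p.2.
    exact/val_inj.
  have headK (p : RT * n.-tuple RT) : head (pair_cons p) = p.1 by [].
  by apply/seteqP; split => p /=; rewrite tailK headK.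
exists (fun k => head @^-1` F k `&` tail @^-1` G k).
  apply/esym; rewrite -subTset => t _.
  have [i _ Fi] : (\bigcup_i F i) (head t) by rewrite -UF.
  have [j _ Gj] : (\bigcup_i G i) (tail t) by rewrite -UG.
  exists (maxn i j) => //; split.
    by have /subsetPset := ndF _ _ (leq_maxl i j); apply.
  by have /subsetPset := ndG _ _ (leq_maxr i j); apply.
move=> k; have [mFk Fk] := mF k; have [mGk Gk] := mG k; split.
  apply: measurableI; rewrite -[X in measurable X]setTI.
    exact: measurable_tnth.
  exact: measurable_behead.
rewrite /lebesgue_step /pushforward Hcons product_measure1E//.
by rewrite lte_mul_pinfty// ge0_fin_numE.
Qed.

HB.instance Definition _ := @Measure_isSigmaFinite.Build _ _ _ lebesgue_step
  lebesgue_step_sigma_finite.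

End lebesgue_step.

Fixpoint lebesgue_tuple (R : realType) (n : nat) :
    {sigma_finite_measure set (n.-tuple (measurableTypeR R)) -> \bar R} :=
  match n with
  | 0 => \d_([tuple] : 0.-tuple (measurableTypeR R))
  | n'.+1 => lebesgue_step (lebesgue_tuple R n')
  end.

Definition row_of_tuple (R : realType) (n : nat)
    (t : n.-tuple (measurableTypeR R)) : borel_space R n :=
  \row_i tnth t i.

Lemma measurable_row_of_tuple (R : realType) (n : nat) :
  measurable_fun setT (@row_of_tuple R n).
Proof.
pose box (q : 'rV[rat]_n) (k : nat) : set 'rV[R]_n :=
  [set y | forall i, ball (ratr (q ord0 i) : R) (k.+1%:R^-1) (y ord0 i)].
apply: (@measurability _ _ (n.-tuple (measurableTypeR R)) (borel_space R n)
  setT (@row_of_tuple R n) open) => //.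
move=> _ [U oU <-]; rewrite setTI.
have -> : @row_of_tuple R n @^-1` U =
    \bigcup_(p : 'rV[rat]_n * nat)
      (if `[< box p.1 p.2 `<=` U >] then @row_of_tuple R n @^-1` (box p.1 p.2)
       else set0).
  apply/seteqP; split => [t /= Ut|t [[q k] _] /=]; last first.
    by case: asboolP => // boxU; apply: boxU.
  have /nbhs_ballP[e /= e0 xeU] := open_nbhs_nbhs (conj oU Ut).
  have [k _ ke] : exists2 k : nat, True & k.+1%:R^-1 < e / 2.
    have e20 : 0 < e / 2 by rewrite divr_gt0.
    have := near_infty_natSinv_lt (PosNum e20).
    by move=> [N _ /(_ N (leqnn N))] /= Ne; exists N.
  have k0 : 0 < k.+1%:R^-1 :> R by rewrite invr_gt0.
  have qP i : {q : rat | ball (tnth t i : R) (k.+1%:R^-1) (ratr q : R)}.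
    apply/cid.
    have /dense_rat : ball (tnth t i : R) (k.+1%:R^-1) !=set0.
      by exists (tnth t i); exact: ballxx.
    move=> /(_ (ball_open (tnth t i : R) _)) [x [Bq [q _ qE]]].
    by exists q; rewrite qE.
  pose q : 'rV[rat]_n := \row_i sval (qP i).
  exists (q, k) => //=; case: asboolP => [_ /= i|].
    by rewrite /row_of_tuple !mxE; apply: ball_sym; exact: svalP (qP i).
  apply => y /= boxy; apply: xeU; split => // i j; rewrite ord1.
  rewrite /row_of_tuple mxE.
  apply: (@le_ball _ _ _ (k.+1%:R^-1 + k.+1%:R^-1)).
    by rewrite [leRHS]splitr lerD// ltW.
  apply: ball_triangle (svalP (qP j)) _.
  by have := boxy j; rewrite mxE.
apply: countable_bigcupT_measurable => [|[q k] /=].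
  exact: countableP.
case: ifPn => // _.
have -> : @row_of_tuple R n @^-1` box q k = \bigcap_(i in [set: 'I_n])
    ((fun t : n.-tuple (measurableTypeR R) => tnth t i) @^-1`
      (ball (ratr (q ord0 i) : R) k.+1%:R^-1)).
  apply/seteqP; split => [t /= tq i _|t /= tq i].
    by have := tq i; rewrite mxE.
  by rewrite mxE; exact: tq.
apply: fin_bigcap_measurable => // i _; rewrite -[X in measurable X]setTI.
apply: measurable_tnth => //.
exact: measurable_realfun.measurable_ball.
Qed.

Lemma lebesgue_tuple_box (R : realType) (n : nat)
    (A : 'I_n -> set (measurableTypeR R)) :
  (forall i, measurable (A i)) ->
  lebesgue_tuple R n [set t | forall i, A i (tnth t i)] =
  (\prod_(i < n) @lebesgue_measure R (A i))%E.
Proof.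
elim: n A => [|n IH] A mA.
  by rewrite big_ord0 /= diracE mem_set// => -[].
rewrite big_ord_recl -IH; last by move=> i; exact: mA.
rewrite -product_measure1E//=.
- congr (product_measure1 _ _ _); apply/seteqP; split => -[x t] /=.
    move=> At; split; first exact: (At ord0).
    move=> i; have := At (lift ord0 i); by rewrite /pair_cons tnthS.
  move=> [Ax At] i; case: (unliftP ord0 i) => [j ->|-> //].
  by rewrite /pair_cons tnthS; exact: At.
- rewrite (_ : [set t | _] = \bigcap_(i in [set: 'I_n])
     ((fun t : n.-tuple (measurableTypeR R) => tnth t i) @^-1` A (lift ord0 i))).
    apply: fin_bigcap_measurable => // i _; rewrite -[X in measurable X]setTI.
    exact: measurable_tnth.
  by apply/seteqP; split => [t /= h i _|t /= h i]; exact: h.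
Qed.

Definition lebesgue_rV (R : realType) (n : nat) :
    {measure set (borel_space R n) -> \bar R} :=
  pushforward_measure (lebesgue_tuple R n) (@measurable_row_of_tuple R n).

Definition cube (R : realType) (n : nat) (a : 'rV[R]_n) (l : R) :
    set 'rV[R]_n :=
  [set y | forall i, a ord0 i <= y ord0 i <= a ord0 i + l].

Lemma lebesgue_rV_cube (R : realType) (n : nat) (a : 'rV[R]_n) (l : R) :
  0 <= l -> lebesgue_rV R n (cube a l) = (l ^+ n)%:E.
Proof.
move=> l0; rewrite /lebesgue_rV /=/pushforward.
rewrite (_ : _ @^-1` _ = 
    [set t | forall i, `[a ord0 i, a ord0 i + l]%classic (tnth t i)]).
  transitivity (\prod_(i < n) @lebesgue_measure R `[a ord0 i, (a ord0 i + l)%R]%classic)%E.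
    apply: (lebesgue_tuple_box (A := fun i => `[a ord0 i, a ord0 i + l]%classic)); move=> i; exact: measurable_itv.
  rewrite (eq_bigr (fun=> l%:E)) ?prodEFin ?prodr_const ?card_ord// => i _.
  by rewrite lebesgue_measure_itv/= lte_fin ltrDl lt_neqAle l0 andbT eq_sym;
     case: eqP => [->//|]; rewrite -EFinD addrAC subrr add0r.
by apply/seteqP; split => t /= h i; have := h i; rewrite mxE in_itv.
Qed.

Definition eball (R : realType) (n : nat) (x : 'rV[R]_n) (r : R) :
    set 'rV[R]_n :=
  [set y | Num.sqrt (\sum_(i < n) (y ord0 i - x ord0 i) ^+ 2) < r].

Definition frac_maximal (R : realType) (n : nat) (alpha : R)
    (mu : {measure set (borel_space R n) -> \bar R}) (x : 'rV[R]_n) : \bar R :=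
  ereal_sup [set ((r `^ alpha)%:E * mu (eball x r)
                    / lebesgue_rV R n (eball x r))%E | r in [set r | 0 < r]].

(* Countable coverings by closed cubes with sides parallel to the axes.
   They are families indexed by a subset D of nat, so that finite (and
   empty) coverings are allowed. *)
Definition hausdorff_delta (R : realType) (n : nat) (s : R) (delta : \bar R)
    (E : set 'rV[R]_n) : \bar R :=
  ereal_inf [set v | exists (D : set nat) (a : nat -> 'rV[R]_n) (l : nat -> R),
    [/\ forall k, D k -> 0 < l k /\ ((l k)%:E <= delta)%E,
        E `<=` \bigcup_(k in D) cube (a k) (l k) &
        v = \esum_(k in D) (l k `^ s)%:E]].

Definition hausdorff (R : realType) (n : nat) (s : R) (E : set 'rV[R]_n) :
    \bar R :=
  ereal_sup [set hausdorff_delta s delta E |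
    delta in [set d : \bar R | (0 < d)%E]].

(* Main.v *)
(* If M mu is finite at x0, then for every x and rho > 0 the bound
   mu(B_r(x)) <= C r^(n-alpha) holds for all r >= rho, as B_r(x) lies in a
   ball about x0 of comparable radius, so M mu(x) can be infinite only because the ratio
   mu(B_r(x)) / r^(n-alpha) is unbounded as r tends to 0.  Then x is close to
   arbitrarily small dyadic cells Q with mu(Q) > t l(Q)^(n-alpha), t being
   arbitrarily large.  The maximal such cells inside a compact set K are
   disjoint and their dilates cover, so the sum of the l^(n-alpha) is at most
   a constant times mu(K) / t.

   Conversely, if M mu were infinite everywhere, then R^n would be
   H^(n-alpha)-null; but for cubes with sides l <= 1 one has
   l^(n-alpha) >= l^n, so a covering of R^n, hence of the unit cube, has sum at
   least 1 by subadditivity of the Lebesgue measure. *)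
Require Import Defs.
From mathcomp Require Import all_boot all_order all_algebra.
From mathcomp Require Import all_classical all_reals all_analysis.
From mathcomp Require Import zify ring lra.

Set Implicit Arguments.
Unset Strict Implicit.
Unset Printing Implicit Defensive.

Import Order.TTheory GRing.Theory Num.Theory.
Import numFieldNormedType.Exports.
Local Open Scope classical_set_scope.
Local Open Scope ring_scope.

(** * Hausdorff contents: null sets and reindexing of coverings *)

Lemma hausdorff_delta_ge0 (R : realType) (n : nat) (s : R) (delta : \bar R)
    (E : set 'rV[R]_n) : (0 <= hausdorff_delta s delta E)%E.
Proof.
apply: le_ereal_inf_tmp => _ [D [a [l [_ _ ->]]]].
by apply: esum_ge0 => k _; rewrite lee_fin powR_ge0.
Qed.

Lemma hausdorff_eq0P (R : realType) (n : nat) (s : R) (E : set 'rV[R]_n) :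
  hausdorff s E = 0%E <->
  forall delta : \bar R, (0 < delta)%E -> hausdorff_delta s delta E = 0%E.
Proof.
split => [H0 delta d0|H0].
  apply/eqP; rewrite eq_le hausdorff_delta_ge0 andbT -H0.
  by apply: ereal_sup_ubound; exists delta.
apply/eqP; rewrite eq_le; apply/andP; split.
  by apply: ge_ereal_sup => _ [delta d0 <-]; rewrite H0.
rewrite -(H0 1%E)//; apply: ereal_sup_ubound.
by exists 1%E => //=.
Qed.

(** Coverings indexed by any countable type are transported to subsets of [nat] along [pickle]. This
    allows coverings indexed by pairs or by dyadic cells. *)
Lemma hausdorff_delta_le_esum (R : realType) (n : nat) (s : R)
    (delta : \bar R) (E : set 'rV[R]_n) (I : countType) (D : set I)
    (a : I -> 'rV[R]_n) (l : I -> R) :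
  (forall i, D i -> 0 < l i /\ ((l i)%:E <= delta)%E) ->
  E `<=` \bigcup_(i in D) cube (a i) (l i) ->
  (hausdorff_delta s delta E <= \esum_(i in D) (l i `^ s)%:E)%E.
Proof.
move=> Dl ED; apply: ereal_inf_lbound.
(* The default 0 is never read, as the new index set is the image of [pickle]. *)
pose a' m := oapp a 0 (@pickle_inv I m).
pose l' m := oapp l 0 (@pickle_inv I m).
exists (pickle @` D), a', l'; split.
- by move=> _ [i Di <-]; rewrite /l' pickleK_inv; exact: Dl.
- move=> x /ED[i Di xi]; exists (pickle i); first by exists i.
  by rewrite /a' /l' pickleK_inv.
- rewrite esum_image; last first.
    by move=> i j _ _; exact: (pcan_inj (@pickleK_inv I)).
  by apply: eq_esum => i _; rewrite /l' pickleK_inv.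
Qed.

(** Coverings of the [E N] with sums at most [e / 2 ^ N.+1] together form one covering indexed by
    pairs, with sum at most [e]. *)
Lemma hausdorff_delta_bigcup_eq0 (R : realType) (n : nat) (s : R)
    (delta : \bar R) (E : nat -> set 'rV[R]_n) :
  (forall N, hausdorff_delta s delta (E N) = 0%E) ->
  hausdorff_delta s delta (\bigcup_N E N) = 0%E.
Proof.
move=> E0; apply/eqP; rewrite eq_le hausdorff_delta_ge0 andbT.
apply/lee_addgt0Pr => e e0; rewrite add0e.
have /choice[D] : forall N,
    exists Dal : set nat * (nat -> 'rV[R]_n) * (nat -> R),
    [/\ forall k, Dal.1.1 k -> 0 < Dal.2 k /\ ((Dal.2 k)%:E <= delta)%E,
        E N `<=` \bigcup_(k in Dal.1.1) cube (Dal.1.2 k) (Dal.2 k) &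
        (\esum_(k in Dal.1.1) (Dal.2 k `^ s)%:E <= (e / (2 ^ N.+1)%:R)%:E)%E].
  move=> N; have : (hausdorff_delta s delta (E N) < (e / (2 ^ N.+1)%:R)%:E)%E.
    by rewrite E0 lte_fin divr_gt0// ltr0n expn_gt0.
  move=> /ereal_inf_lt[_ [D [a [l [Dl ED ->]]]] /ltW lt].
  by exists (D, a, l).
move=> H.
pose l (p : nat * nat) := (D p.1).2 p.2.
pose a (p : nat * nat) := (D p.1).1.2 p.2.
apply: (le_trans (@hausdorff_delta_le_esum R n s delta _ _
  ([set: nat] `*`` (fun N => (D N).1.1)) a l _ _)).
- by move=> [N k] [_ /= Dk]; have [+ _ _] := H N; apply.
- move=> x [N _ ENx]; have [_ /(_ _ ENx)[k Dk xk] _] := H N.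
  by exists (N, k).
rewrite -(@esum_esum _ _ _ setT (fun N => (D N).1.1)
   (fun N k => ((D N).2 k `^ s)%:E)); last first.
  by move=> *; rewrite lee_fin powR_ge0.
apply: (le_trans (le_esum (b := fun N => (e / (2 ^ N.+1)%:R)%:E) _)).
  by move=> N _; have [_ _] := H N.
rewrite -nneseries_esumT; last first.
  by move=> N; rewrite lee_fin divr_ge0// ltW.
by apply: epsilon_trick0; exact: ltW.
Qed.

(** * Measurability and volume of balls and cubes *)

Lemma borel_measureS (R : realType) (n : nat)
    (mu : {measure set (borel_space R n) -> \bar R}) (A B : set 'rV[R]_n) :
  measurable (A : set (borel_space R n)) ->
  measurable (B : set (borel_space R n)) -> A `<=` B -> (mu A <= mu B)%E.
Proof. by move=> mA mB; apply: (@le_measure _ _ _ mu); rewrite ?inE. Qed.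

Lemma open_eball (R : realType) (n : nat) (x : 'rV[R]_n) (r : R) :
  open (eball x r).
Proof.
rewrite (_ : eball x r = (fun y : 'rV[R]_n =>
  Num.sqrt (\sum_(i < n) (y ord0 i - x ord0 i) ^+ 2)) @^-1` [set t | t < r])//.
apply: open_comp; last exact: open_lt.
move=> y _; apply: continuous_comp; last exact: sqrt_continuous.
apply: continuous_big; first exact: add_continuous.
move=> i _ z; apply: (@continuous_comp _ _ _
  (fun y : 'rV[R]_n => y ord0 i - x ord0 i) (fun t => t ^+ 2));
  last exact: exprn_continuous.
apply: continuousB; [exact: coord_continuous|exact: cst_continuous].
Qed.

Lemma measurable_eball (R : realType) (n : nat) (x : 'rV[R]_n) (r : R) :
  measurable (eball x r : set (borel_space R n)).
Proof. by apply: sub_sigma_algebra; exact: open_eball. Qed.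

Lemma measurable_coord_preimage (R : realType) (n : nat)
    (A : 'I_n -> set R) : (forall i, measurable (A i)) ->
  measurable ([set y : 'rV[R]_n | forall i, A i (y ord0 i)]
    : set (borel_space R n)).
Proof.
move=> mA; rewrite (_ : [set y | _] = \bigcap_(i in [set: 'I_n])
    ((fun y : 'rV[R]_n => y ord0 i) @^-1` A i)).
  apply: fin_bigcap_measurable => // i _.
  rewrite -[X in measurable X]setTI.
  suff : measurable_fun setT
      (fun y : borel_space R n => y ord0 i : measurableTypeR R).
    by move=> mf; exact: (mf measurableT _ (mA i)).
  apply: (measurability _ (measurable_realfun.RGenOpens.measurableE R)) => //.
  move=> _ [_ [a [b ->]] <-]; rewrite setTI; apply: sub_sigma_algebra.
  by apply: open_comp => [y _|]; [exact: coord_continuous|exact: interval_open].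
by apply/seteqP; split => [y /= h i _|y /= h i]; exact: h.
Qed.

Lemma measurable_cube (R : realType) (n : nat) (a : 'rV[R]_n) (l : R) :
  measurable (cube a l : set (borel_space R n)).
Proof.
rewrite (_ : cube a l =
    [set y | forall i, `[a ord0 i, a ord0 i + l]%classic (y ord0 i)]).
  exact: (measurable_coord_preimage
    (A := fun i => `[a ord0 i, a ord0 i + l]%classic)).
by apply/seteqP; split => y /= h i; have := h i; rewrite in_itv.
Qed.

Lemma compact_cube (R : realType) (n : nat) (a : 'rV[R]_n) (l : R) :
  compact (cube a l).
Proof.
rewrite (_ : cube a l =
    [set y | forall i, `[a ord0 i, a ord0 i + l]%classic (y ord0 i)]).
  apply: (@rV_compact _ _ (fun i => `[a ord0 i, a ord0 i + l]%classic)) => i.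
  exact: segment_compact.
by apply/seteqP; split => y /= h i; have := h i; rewrite in_itv.
Qed.

Lemma eball_coord (R : realType) (n : nat) (x y : 'rV[R]_n) (r : R) (i : 'I_n) :
  eball x r y -> `|y ord0 i - x ord0 i| < r.
Proof.
apply: le_lt_trans; rewrite -sqrtr_sqr; apply: ler_wsqrtr.
by rewrite (bigD1 i)//= lerDl sumr_ge0// => j _; exact: sqr_ge0.
Qed.

(** The Euclidean distance is at most [d] times the square root of [n]; the cruder factor [n.+1]
    makes the inequality strict, also for [n = 0]. *)
Lemma coord_eball (R : realType) (n : nat) (x y : 'rV[R]_n) (d : R) :
  0 < d -> (forall i, `|y ord0 i - x ord0 i| <= d) -> eball x (n.+1%:R * d) y.
Proof.
move=> d0 xyd; have nd0 : 0 < n.+1%:R * d by rewrite mulr_gt0.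
rewrite /eball /= -[ltRHS]gtr0_norm// -sqrtr_sqr ltr_sqrt ?exprn_gt0//.
apply: (@le_lt_trans _ _ (\sum_(i < n) d ^+ 2)).
  apply: ler_sum => i _; rewrite -real_normK ?num_real//.
  by rewrite ler_pXn2r ?nnegrE// ltW.
rewrite sumr_const card_ord exprMn -[ltLHS]mulr_natl ltr_pM2r ?exprn_gt0//.
by rewrite -natrX ltr_nat; nia.
Qed.

Lemma lebesgue_eball_le (R : realType) (n : nat) (x : 'rV[R]_n) (r : R) :
  0 < r -> (lebesgue_rV R n (eball x r) <= ((2 * r) ^+ n)%:E)%E.
Proof.
move=> r0; have r2 : 0 <= 2 * r by rewrite mulr_ge0// ltW.
rewrite -(lebesgue_rV_cube (x - const_mx r) r2).
apply: borel_measureS; [exact: measurable_eball|exact: measurable_cube|].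
move=> y xy i; have := eball_coord i xy; rewrite ltr_norml !mxE.
by move=> /andP[h1 h2]; lra.
Qed.

Lemma lebesgue_eball_ge (R : realType) (n : nat) (x : 'rV[R]_n) (r : R) :
  0 < r -> (((r / n.+1%:R) ^+ n)%:E <= lebesgue_rV R n (eball x r))%E.
Proof.
move=> r0; have d0 : 0 < r / n.+1%:R by rewrite divr_gt0.
(* The inscribed cube has [x] as a corner, not as its centre. *)
rewrite -(lebesgue_rV_cube x (ltW d0)).
apply: borel_measureS; [exact: measurable_cube|exact: measurable_eball|].
move=> y xy; have -> : r = n.+1%:R * (r / n.+1%:R) by rewrite mulrC divfK.
apply: coord_eball => // i; move: (xy i) d0; move: (r / _) => d.
by rewrite ler_norml; lra.
Qed.

(** * Finiteness of the maximal function as a growth bound on balls *)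

Lemma powR_mul_conjugate (R : realType) (n : nat) (alpha r : R) : 0 < r ->
  r `^ alpha * r `^ (n%:R - alpha) = r ^+ n.
Proof.
move=> r0; rewrite -powRD ?(gt_eqF r0) ?implybT// addrC subrK.
by rewrite powR_mulrn// ltW.
Qed.

(** The volume of a ball of radius [r] lies between [(r / n.+1) ^ n] and [(2 * r) ^ n], so up to
    constants the quotient in the supremum is [mu (eball x r)] over [r] to the power [n - alpha]. *)
Lemma frac_maximal_ltyP (R : realType) (n : nat)
    (mu : {measure set (borel_space R n) -> \bar R}) (alpha : R)
    (x : 'rV[R]_n) :
  (frac_maximal alpha mu x < +oo)%E <->
  exists2 C : R, 0 <= C & forall r : R, 0 < r ->
    (mu (eball x r) <= (C * r `^ (n%:R - alpha))%:E)%E.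
Proof.
have lebP r : 0 < r -> exists l : R, [/\ lebesgue_rV R n (eball x r) = l%:E,
    0 < l, l <= (2 * r) ^+ n & (r / n.+1%:R) ^+ n <= l].
  move=> r0; have := lebesgue_eball_le x r0; have := lebesgue_eball_ge x r0.
  case: (lebesgue_rV R n (eball x r)) => [l| |]//; rewrite !lee_fin => h1 h2.
  by exists l; split => //; apply: lt_le_trans h1; rewrite exprn_gt0// divr_gt0.
split => [Mfin|[C C0 muC]].
  (* The maximum with 0 gives a nonnegative bound without a discussion of the sign of the
     supremum. *)
  have [c c0 Mc] : exists2 c : R, 0 <= c & (frac_maximal alpha mu x <= c%:E)%E.
    move: Mfin; case: (frac_maximal _ _ _) => [c _| |_]//.
      by exists (Num.max c 0); rewrite ?lee_fin le_max lexx ?orbT.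
    by exists 0; rewrite ?leNye.
  exists (c * 2 ^+ n) => [|r r0]; first by rewrite mulr_ge0// exprn_ge0.
  have [l [lE l0 l2 _]] := lebP _ r0.
  have ra0 : 0 < r `^ alpha by exact: powR_gt0.
  have : ((r `^ alpha)%:E * mu (eball x r) / l%:E <= c%:E)%E.
    apply: le_trans Mc; rewrite -lE; apply: ereal_sup_ubound.
    by exists r.
  rewrite inver gt_eqF// lee_pdivrMr// muleC -lee_pdivlMr// => /le_trans; apply.
  rewrite -EFinM lee_fin ler_pdivrMr// -!mulrA ler_wpM2l//.
  by rewrite [X in _ * X]mulrC powR_mul_conjugate// -exprMn.
apply: (@le_lt_trans _ _ (C * n.+1%:R ^+ n)%:E); last exact: ltry.
apply: ge_ereal_sup => _ [r /= r0 <-].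
have [l [-> l0 _ l1]] := lebP _ r0.
have ra0 : 0 < r `^ alpha by exact: powR_gt0.
rewrite inver gt_eqF// lee_pdivrMr// muleC.
apply: (le_trans (lee_wpmul2r _ (muC _ r0))); first by rewrite lee_fin ltW.
rewrite -!EFinM lee_fin -!mulrA ler_wpM2l//.
rewrite [leLHS]mulrC powR_mul_conjugate//.
by rewrite mulrC -ler_pdivrMr ?exprn_gt0// -expr_div_n.
Qed.

(** If the small radii all failed, the bound with [t] below [rho] and the bound inherited from [x0]
    above [rho] would make the maximal function finite at [x]. *)
Lemma frac_maximal_inftyP (R : realType) (n : nat)
    (mu : {measure set (borel_space R n) -> \bar R}) (alpha : R)
    (x0 x : 'rV[R]_n) : alpha < n%:R ->
  (frac_maximal alpha mu x0 < +oo)%E -> frac_maximal alpha mu x = +oo%E ->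
  forall t rho : R, 0 < rho -> exists2 r, 0 < r < rho &
    ((t * r `^ (n%:R - alpha))%:E < mu (eball x r))%E.
Proof.
move=> alphan /frac_maximal_ltyP[C C0 muC] Mx t rho rho0.
apply: contrapT => small.
suff : (frac_maximal alpha mu x < +oo)%E by rewrite Mx ltxx.
set s := n%:R - alpha; have s0 : 0 <= s by rewrite subr_ge0 ltW.
have [d d0 xd] : exists2 d : R, 0 <= d & forall i, `|x ord0 i - x0 ord0 i| <= d.
  exists (\sum_i `|x ord0 i - x0 ord0 i|) => [|i]; first exact: sumr_ge0.
  by rewrite (bigD1 i)//= lerDl sumr_ge0.
have dA0 : 0 < d / rho + 1 by rewrite ltr_wpDl// divr_ge0// ltW.
(* For [r >= rho] a point of the ball about [x] differs from [x0] by at most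
   [d + r <= (d / rho + 1) * r] in each coordinate; [n.+1] comes from [coord_eball]. *)
pose A : R := n.+1%:R * (d / rho + 1).
have A0 : 0 < A by rewrite mulr_gt0.
apply/frac_maximal_ltyP; exists (Num.max t (C * A `^ s)).
  by rewrite le_max mulr_ge0 ?powR_ge0 ?orbT.
move=> r r0; have [rrho|rhor] := ltP r rho.
  rewrite leNgt; apply/negP => h; apply: small; exists r; first by rewrite r0.
  apply: le_lt_trans h; rewrite lee_fin ler_wpM2r ?powR_ge0//.
  by rewrite le_max lexx.
apply: (@le_trans _ _ (mu (eball x0 (A * r)))).
  apply: borel_measureS; [exact: measurable_eball|exact: measurable_eball|].
  move=> y xy; rewrite /A -mulrA; apply: coord_eball.
    by rewrite mulr_gt0.
  move=> i; have := xd i; have := eball_coord i xy.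
  have : d <= d / rho * r.
    by rewrite -mulrA ler_peMr// mulrC ler_pdivlMr// mul1r.
  rewrite mulrDl mul1r => h1 h2 h3.
  rewrite -[y ord0 i - _](subrKA (x ord0 i)) (le_trans (ler_normD _ _))//.
  by rewrite addrC lerD// ?(le_trans h3)// ltW.
apply: (le_trans (muC _ (mulr_gt0 A0 r0))).
rewrite lee_fin powRM ?(ltW A0) ?(ltW r0)// mulrA ler_wpM2r ?powR_ge0//.
by rewrite le_max lexx orbT.
Qed.

(** * The whole space has positive content *)

Lemma hausdorff_delta_setT_ge1 (R : realType) (n : nat) (s : R) : s <= n%:R ->
  (1 <= hausdorff_delta s 1 [set: 'rV[R]_n])%E.
Proof.
move=> sn; apply: le_ereal_inf_tmp => _ [D [a [l [Dl Dcover ->]]]].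
(* Indices outside [D] get the empty set, since subadditivity is stated for sequences. *)
pose F k : set 'rV[R]_n := if k \in D then cube (a k) (l k) else set0.
have mF k : measurable (F k : set (borel_space R n)).
  by rewrite /F; case: ifPn => // _; exact: measurable_cube.
have <- : lebesgue_rV R n (cube 0 1) = 1%E by rewrite lebesgue_rV_cube// expr1n.
have := @measure_sigma_subadditive _ _ _ (lebesgue_rV R n) (cube 0 1) F mF
  (measurable_cube 0 1).
have cubeF : cube 0 1 `<=` \bigcup_k F k.
  move=> x _; have [k Dk xk] := Dcover x Logic.I.
  by exists k => //; rewrite /F mem_set.
move=> /(_ cubeF) /le_trans; apply.
rewrite nneseries_esumT// [leRHS]esum_mkcond; apply: le_esum => k _.
rewrite /F; case: ifPn => [/set_mem Dk|_]; last by rewrite measure0.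
have [lk0] := Dl _ Dk; rewrite lee_fin => lk1.
rewrite (lebesgue_rV_cube _ (ltW lk0)) lee_fin -powR_mulrn ?(ltW lk0)//.
by rewrite ger_powR // lk0.
Qed.

(** * Dyadic cells *)

Definition dyadic_index (R : realType) (n k : nat) (y : 'rV[R]_n) :
    'rV[int]_n :=
  \row_i Num.floor (2 ^+ k * y ord0 i).

(** This is the half-open cube with corner [z / 2 ^ k] and side [2 ^- k]. As fibres of
    [dyadic_index k], the cells of one level partition the space. *)
Definition dyadic_cell (R : realType) (n k : nat) (z : 'rV[int]_n) :
  set 'rV[R]_n := [set y | dyadic_index k y = z].

Lemma measurable_dyadic_cell (R : realType) (n k : nat) (z : 'rV[int]_n) :
  measurable (dyadic_cell k z : set (borel_space R n)).
Proof.
rewrite (_ : dyadic_cell k z = [set y : 'rV[R]_n | forall i,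
    `[(z ord0 i)%:~R / 2 ^+ k, (z ord0 i + 1)%:~R / 2 ^+ k[%classic
      (y ord0 i)]).
  exact: (measurable_coord_preimage (A := fun i =>
    `[(z ord0 i)%:~R / 2 ^+ k, (z ord0 i + 1)%:~R / 2 ^+ k[%classic)).
have k0 : 0 < 2 ^+ k :> R by rewrite exprn_gt0.
apply/seteqP; split => y /=.
  move=> <- i; rewrite mxE in_itv /= ler_pdivrMr// ltr_pdivlMr// mulrC.
  exact: floor_itv.
move=> yz; apply/rowP => i; rewrite mxE; apply: floor_def.
by have := yz i; rewrite in_itv /= ler_pdivrMr// ltr_pdivlMr// mulrC.
Qed.

(** One-dimensional nesting of consecutive levels. If [floor a < floor b], then [2 * a < 2 * (floor
    a + 1) <= 2 * floor b <= floor (2 * b) = floor (2 * a) <= 2 * a], a contradiction. *)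
Lemma floor_double_inj (R : realType) (a b : R) :
  Num.floor (2 * a) = Num.floor (2 * b) -> Num.floor a = Num.floor b.
Proof.
wlog ab : a b / Num.floor a < Num.floor b => [W|E].
  have [/W|/W H /esym/H|] := ltgtP (Num.floor a) (Num.floor b); by [].
have := floor_itv (2 * a); rewrite E => /andP[h1 h2].
have := floor_itv (2 * b) => /andP[h3 h4].
have /andP[h5 h6] := floor_itv a.
have /andP[h7 h8] := floor_itv b.
have : 2 * Num.floor b <= Num.floor (2 * b).
  by rewrite floor_ge_int intrM ler_pM2l.
have : 2 * (Num.floor a + 1)%:~R <= 2 * (Num.floor b)%:~R :> R.
  by rewrite ler_pM2l// ler_int lezD1.
rewrite -(ler_int R) intrM => ab' b2; have : 2 * a < 2 * a by lra.
by rewrite ltxx.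
Qed.

Lemma dyadic_index_le (R : realType) (n j k : nat) (x y : 'rV[R]_n) :
  (j <= k)%N -> dyadic_index k x = dyadic_index k y ->
  dyadic_index j x = dyadic_index j y.
Proof.
elim: k => [|k IH]; first by rewrite leqn0 => /eqP ->.
rewrite leq_eqVlt => /predU1P[-> //|jk] xy; apply: IH => //.
apply/rowP => i; have := congr1 (fun z : 'rV_n => z ord0 i) xy.
by rewrite !mxE !exprS -!mulrA; exact: floor_double_inj.
Qed.

Lemma dyadic_cell_dist (R : realType) (n k : nat) (x y : 'rV[R]_n)
    (i : 'I_n) :
  `|dyadic_index k x ord0 i - dyadic_index k y ord0 i| <= 1 ->
  `|x ord0 i - y ord0 i| <= 2 * 2 ^- k.
Proof.
rewrite !mxE; set u := x _ _; set v := y _ _.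
have k0 : 0 < 2 ^+ k :> R by rewrite exprn_gt0.
have /andP[h5 h6] := floor_itv (2 ^+ k * u).
have /andP[h7 h8] := floor_itv (2 ^+ k * v).
rewrite -(ler_int R) intr_norm rmorphB /= ler_norml => /andP[h1 h2].
rewrite ler_pdivlMr// -[X in _ * X]gtr0_norm// -normrM ler_norml.
rewrite !intrD in h6 h8; lra.
Qed.

Lemma dyadic_index_near (R : realType) (n k : nat) (x y : 'rV[R]_n) (i : 'I_n) :
  `|x ord0 i - y ord0 i| <= 2 ^- k ->
  `|dyadic_index k x ord0 i - dyadic_index k y ord0 i| <= 1.
Proof.
rewrite !mxE; set u := x _ _; set v := y _ _.
have k0 : 0 < 2 ^+ k :> R by rewrite exprn_gt0.
have /andP[h5 h6] := floor_itv (2 ^+ k * u).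
have /andP[h7 h8] := floor_itv (2 ^+ k * v).
rewrite -[leRHS]mul1r ler_pdivlMr// -[X in _ * X]gtr0_norm// -normrM ler_norml.
move=> /andP[h1 h2]; rewrite !intrD in h6 h8.
(* Over the reals the indices differ by strictly less than 2, hence as integers by at most 1. *)
have : (Num.floor (2 ^+ k * u))%:~R < (Num.floor (2 ^+ k * v) + 2)%:~R :> R.
  rewrite intrD; lra.
have : (Num.floor (2 ^+ k * v))%:~R < (Num.floor (2 ^+ k * u) + 2)%:~R :> R.
  rewrite intrD; lra.
by rewrite !ltr_int; lia.
Qed.

(** Pigeonhole: a ball of radius at most [2 ^- k] is covered by the [3 ^ n] cells equal or adjacent
    to that of [x], so one of them carries more than the share [v]. *)
Lemma eball_dyadic_cell (R : realType) (n : nat)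
    (mu : {measure set (borel_space R n) -> \bar R}) (x : 'rV[R]_n) (r v : R)
    (k : nat) : r <= 2 ^- k -> (((3 ^ n)%:R * v)%:E < mu (eball x r))%E ->
  exists z, (v%:E < mu (dyadic_cell k z))%E /\
    forall y, dyadic_cell k z y -> forall i,
      `|x ord0 i - y ord0 i| <= 2 * 2 ^- k.
Proof.
move=> rk muv; pose z (f : {ffun 'I_n -> 'I_3}) : 'rV[int]_n :=
  \row_i (dyadic_index k x ord0 i + (f i)%:Z - 1).
have [f vf] : exists f, (v%:E < mu (dyadic_cell k (z f)))%E.
  apply: contrapT => /forallNP zv; move: muv; apply/negP; rewrite -leNgt.
  apply: (le_trans (@content_sub_fsum _ _ _ mu _ setT (eball x r)
    (fun f => dyadic_cell k (z f)) _ _ _ _)) => //.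
  - exact: finite_finset.
  - by move=> f _; exact: measurable_dyadic_cell.
  - exact: measurable_eball.
  - move=> y xy.
    have near i : `|dyadic_index k y ord0 i - dyadic_index k x ord0 i| <= 1.
      by apply: dyadic_index_near; exact/ltW/(lt_le_trans (eball_coord i xy)).
    exists [ffun i => inord (absz (dyadic_index k y ord0 i -
      dyadic_index k x ord0 i + 1))] => //.
    apply/rowP => i; have := near i; rewrite [RHS]mxE ffunE.
    rewrite -[LHS]/(dyadic_index k y ord0 i).
    move: (dyadic_index k y _ _) (dyadic_index k x _ _) => p q pq.
    by rewrite inordK; lia.
  rewrite (@fsbigE _ _ _ _ _ (index_enum _)) ?index_enum_uniq//; last first.
    by move=> f _; rewrite mem_index_enum.
  rewrite (eq_bigl xpredT) => [|f]; last by rewrite in_setT.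
  apply: (@le_trans _ _ (\sum_(f : {ffun 'I_n -> 'I_3}) v%:E)%E).
    by apply: lee_sum => f _; rewrite leNgt; apply/negP; exact: zv.
  by rewrite sumEFin sumr_const card_ffun !card_ord lee_fin mulr_natl.
exists (z f); split => // y /= yz i; apply: dyadic_cell_dist.
rewrite yz [X in _ - X]mxE; have := ltn_ord (f i); lia.
Qed.

(** * Covering by maximal dyadic cells *)

(** A stopping argument: among the cells in [K] of level at least [k0] and density above [t], the
    maximal ones are disjoint by nesting, and cubes five times as wide cover [E]. Their sum is at
    most [e / M] times the measure of [K]. *)
Lemma hausdorff_delta_eq0_dense_cells (R : realType) (n : nat)
    (mu : {measure set (borel_space R n) -> \bar R}) (s : R)
    (K E : set 'rV[R]_n) (delta : \bar R) :
  measurable (K : set (borel_space R n)) -> (mu K < +oo)%E -> (0 < delta)%E ->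
  (forall (t : R) (k0 : nat) x, E x -> exists k z, [/\ (k0 <= k)%N,
     dyadic_cell k z `<=` K,
     ((t * (2 ^- k) `^ s)%:E < mu (dyadic_cell k z))%E &
     exists2 y, dyadic_cell k z y &
       forall i, `|x ord0 i - y ord0 i| <= 2 * 2 ^- k]) ->
  hausdorff_delta s delta E = 0%E.
Proof.
(* Here [w] is the corner of a selected cell of side [q], [u] a point in it and [v] a point of [E]
   within [2 * c] of [u]. So [v] lies between [w - 2 * q] and [w + 3 * q], whence the factor 5. *)
have arith (w u v c q : R) : w <= u -> u < w + q -> `|v - u| <= 2 * c ->
    c <= q -> w - 2 * q <= v <= w - 2 * q + 5 * q by rewrite ler_norml; lra.
move=> mK Kfin delta0 dense; apply/eqP; rewrite eq_le hausdorff_delta_ge0 andbT.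
apply/lee_addgt0Pr => e e0; rewrite add0e.
have [M M0 KM] : exists2 M : R, 0 < M & (mu K <= M%:E)%E.
  exists (fine (mu K) + 1); first by rewrite ltr_wpDl// fine_ge0.
  by rewrite -[leLHS]fineK ?ge0_fin_numE// lee_fin lerDl.
have [k0 k0delta] : exists k0 : nat, ((5 * 2 ^- k0)%:E <= delta)%E.
  case: delta delta0 => [d| |]//; last by exists 0; rewrite leey.
  rewrite lte_fin => d0.
  have [k kd] : exists k : nat, 5 / d <= k%:R.
    by exists (Num.truncn (5 / d)).+1; apply/ltW/truncnS_gt.
  exists k; rewrite lee_fin ler_pdivrMr ?exprn_gt0// mulrC -ler_pdivrMr//.
  by apply: (le_trans kd); rewrite -natrX ler_nat ltnW// ltn_expl.
(* Chosen so that [e / M * t] is the factor [5] to the power [s] lost by the dilation. *)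
pose t := 5 `^ s * M / e.
have s5 : 0 < 5 `^ s by rewrite powR_gt0.
have t0 : 0 < t by rewrite divr_gt0// mulr_gt0.
pose good k z := [/\ (k0 <= k)%N, dyadic_cell k z `<=` K &
  ((t * (2 ^- k) `^ s)%:E < mu (dyadic_cell k z))%E].
(* Maximality: no coarser cell containing a point [y] of the cell is good. *)
pose D : set (nat * 'rV[int]_n) := [set p | good p.1 p.2 /\
  forall j (y : 'rV[R]_n), (j < p.1)%N -> dyadic_cell p.1 p.2 y ->
    ~ good j (dyadic_index j y)].
pose cell (p : nat * 'rV[int]_n) : set (borel_space R n) := dyadic_cell p.1 p.2.
have mcell p : measurable (cell p) by exact: measurable_dyadic_cell.
have disjD : trivIset D cell.
  move=> [k z] [j w] [goodk maxk] [goodj maxj] [x []].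
  rewrite /cell /dyadic_cell/= => kz jw.
  have [jk|kj|jk] := ltngtP j k.
  - by have := maxk j x jk kz; rewrite jw.
  - by have := maxj k x kj jw; rewrite kz.
  - by rewrite -kz -jw jk.
pose a (p : nat * 'rV[int]_n) : 'rV[R]_n :=
  \row_i ((p.2 ord0 i)%:~R / 2 ^+ p.1 - 2 / 2 ^+ p.1).
pose l (p : nat * 'rV[int]_n) : R := 5 * 2 ^- p.1.
have coverD : E `<=` \bigcup_(p in D) cube (a p) (l p).
  move=> x /(dense t k0)[k [z [k0k cellK muz [y yz xy]]]].
  have ex_good : exists j, `[< good j (dyadic_index j y) >].
    by exists k; apply/asboolP; rewrite yz.
  (* The least good level at [y] gives the largest good cell containing [y]. *)
  pose j := ex_minn ex_good.
  have [goodj minj] : good j (dyadic_index j y) /\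
      forall i, good i (dyadic_index i y) -> (j <= i)%N.
    rewrite /j; case: ex_minnP => m /asboolP gm minm; split => // i gi.
    exact/minm/asboolP.
  exists (j, dyadic_index j y).
    split => //= i y' ij y'j; rewrite (dyadic_index_le (ltnW ij) y'j).
    by move=> /minj; rewrite leqNgt ij.
  have jk : (j <= k)%N by apply: minj; rewrite yz.
  have j20 : 0 < 2 ^+ j :> R by rewrite exprn_gt0.
  have kj : 2 ^- k <= 2 ^- j :> R.
    by rewrite lef_pV2 ?posrE ?exprn_gt0// ler_weXn2l// ler1n.
  move=> i; rewrite /a /l !mxE /=; apply: arith (xy i) kj.
    by rewrite ler_pdivrMr// mulrC; exact: floor_le.
  have := floorD1_gt (2 ^+ j * y ord0 i).
  by rewrite mulrC -ltr_pdivlMr// intrD mulrDl mul1r.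
have lD p : D p -> 0 < l p /\ ((l p)%:E <= delta)%E.
  move=> [[k0p _ _] _]; split; first by rewrite mulr_gt0// invr_gt0 exprn_gt0.
  apply: le_trans k0delta; rewrite lee_fin ler_pM2l//.
  by rewrite lef_pV2 ?posrE ?exprn_gt0// ler_weXn2l// ler1n.
apply: (le_trans (hausdorff_delta_le_esum s lD coverD)).
(* The sum over [D] is a supremum of finite sums, so it is enough to bound these. *)
apply: ge_ereal_sup => _ [X [finX XD] <-].
apply: (@le_trans _ _ (\sum_(p \in X) (e / M)%:E * mu (cell p))%E).
  apply: lee_fsum => // p /XD[[_ _ /ltW mup] _].
  apply: le_trans (lee_wpmul2l _ mup); last first.
    by rewrite lee_fin divr_ge0// ltW.
  rewrite -EFinM lee_fin powRM// ?invr_ge0 ?exprn_ge0// mulrA.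
  rewrite ler_wpM2r ?powR_ge0//.
  by rewrite (_ : e / M * t = 5 `^ s)// /t; field; rewrite !gt_eqF.
rewrite -ge0_mule_fsumr// -measure_fin_bigcup//; last first.
  by apply: sub_trivIset disjD.
apply: (@le_trans _ _ ((e / M)%:E * M%:E)%E).
  apply: lee_wpmul2l; first by rewrite lee_fin divr_ge0// ltW.
  apply: le_trans KM; apply: borel_measureS => //.
    exact: fin_bigcup_measurable.
  by move=> x [p /XD[[_ pK _] _] px]; exact: pK.
by rewrite -EFinM lee_fin divfK// gt_eqF.
Qed.

(** * Nullity of the infinity set, and the equivalence *)

Lemma hausdorff_delta_frac_maximal_infty (R : realType) (n : nat)
    (mu : {measure set (borel_space R n) -> \bar R}) (alpha : R)
    (delta : \bar R) : locally_finite mu -> alpha < n%:R -> (0 < delta)%E ->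
  (exists x0 : 'rV[R]_n, (frac_maximal alpha mu x0 < +oo)%E) ->
  hausdorff_delta (n%:R - alpha) delta
    [set x : 'rV[R]_n | frac_maximal alpha mu x = +oo%E] = 0%E.
Proof.
move=> muK alphan delta0 [x0 Mx0]; set s := n%:R - alpha.
have s0 : 0 <= s by rewrite subr_ge0 ltW.
pose E N : set 'rV[R]_n := [set x | frac_maximal alpha mu x = +oo%E /\
  forall i, `|x ord0 i| <= N%:R].
rewrite (_ : [set _ | _] = \bigcup_N E N); last first.
  apply/seteqP; split => [x /= Mx|x [N _ []]//].
  exists (Num.truncn (\sum_i `|x ord0 i|)).+1 => //; split => // i.
  apply: le_trans (ltW (truncnS_gt _)).
  by rewrite (bigD1 i)//= lerDl sumr_ge0.
apply: hausdorff_delta_bigcup_eq0 => N.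
(* The margin 2 contains every cell used, as its points are within [2 * 2 ^- k <= 2] of a point of
   [E N] in each coordinate. *)
pose K : set 'rV[R]_n := cube (const_mx (- (N%:R + 2))) (2 * (N%:R + 2)).
apply: (@hausdorff_delta_eq0_dense_cells _ _ mu _ K) => //.
- exact: measurable_cube.
- exact/muK/compact_cube.
move=> t k0 x [Mx xN].
have k00 : 0 < 2 ^- k0 :> R by rewrite invr_gt0 exprn_gt0.
(* The factor [3 ^ n] pays for the pigeonhole and [2] to the power [s] for replacing [r] by
   [2 ^- k <= 2 * r]. With [Num.max t 0] the threshold is nonnegative, so the cell found has
   positive measure and is not empty. *)
have [r /andP[r0 rk0]] := frac_maximal_inftyP alphan Mx0 Mx
  ((3 ^ n)%:R * Num.max t 0 * 2 `^ s) k00.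
have [k [k0k rk kr]] :
    exists k, [/\ (k0 <= k)%N, r <= 2 ^- k & 2 ^- k <= 2 * r].
  have ex_k : exists k, 2 ^- k.+1 < r.
    exists (Num.truncn r^-1); rewrite invf_plt ?posrE ?exprn_gt0//.
    by rewrite (lt_trans (truncnS_gt _))// -natrX ltr_nat ltn_expl.
  case: (ex_minnP ex_k) => k kr mink; exists k.
  have k0k : (k0 <= k)%N.
    rewrite leqNgt; apply/negP => kk0; have := lt_trans kr rk0.
    by rewrite ltf_pV2 ?posrE ?exprn_gt0// ltNge ler_weXn2l// ler1n.
  split => //.
  - rewrite leNgt; apply/negP => rk.
    (* At level 0 minimality says nothing; there [k0 = 0], and [r < 2 ^- k0] gives the bound. *)
    case: k kr mink k0k rk => [|k] kr mink k0k rk.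
      have k0E : k0 = 0%N by move: k0k; rewrite leqn0 => /eqP.
      by move: (lt_trans rk rk0); rewrite k0E ltxx.
    by have := mink k rk; rewrite ltnn.
  - by move: kr; rewrite exprS invfM => /ltW; rewrite ler_pdivrMl.
rewrite -/s => mur.
have [z [muz xz]] : exists z : 'rV[int]_n,
    ((Num.max t 0 * (2 ^- k) `^ s)%:E < mu (dyadic_cell k z))%E /\
    forall y, dyadic_cell k z y -> forall i,
      `|x ord0 i - y ord0 i| <= 2 * 2 ^- k.
  apply: eball_dyadic_cell rk _; apply: le_lt_trans mur.
  rewrite lee_fin -!mulrA ler_wpM2l// ler_wpM2l ?le_max ?lexx ?orbT//.
  rewrite -powRM ?ler0n ?(ltW r0)//.
  by rewrite ge0_ler_powR// nnegrE ?mulr_ge0 ?(ltW r0)// invr_ge0 exprn_ge0.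
exists k, z; split => //.
- move=> y /xz xy i; have := xN i; have := xy i; rewrite !mxE.
  have : 2 ^- k <= 1 :> R by rewrite invf_le1 ?exprn_gt0// exprn_ege1// ler1n.
  rewrite !ler_norml; lra.
- apply: le_lt_trans muz; rewrite lee_fin ler_wpM2r ?powR_ge0//.
  by rewrite le_max lexx.
- have : (dyadic_cell k z : set 'rV[R]_n) !=set0.
    apply: contrapT => /nonemptyPn cell0.
    move: muz; rewrite cell0 measure0 lte_fin.
    by rewrite ltNge mulr_ge0 ?powR_ge0// le_max lexx orbT.
  by move=> [y yz]; exists y => //; exact: xz.
Qed.

Unset Implicit Arguments.

Theorem theorem2p2 (R : realType) (n : nat)
    (mu : {measure set (borel_space R n) -> \bar R})
    (hmu : locally_finite mu)
    (alpha : R) (halpha0 : 0 <= alpha) (halphan : alpha < n%:R) :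
  (exists x0 : 'rV[R]_n, (frac_maximal alpha mu x0 < +oo)%E) <->
  hausdorff (n%:R - alpha)
    [set x : 'rV[R]_n | frac_maximal alpha mu x = +oo%E] = 0%E.
Proof.
split => [Mx0|].
  apply/hausdorff_eq0P => delta delta0.
  exact: hausdorff_delta_frac_maximal_infty.
move=> /hausdorff_eq0P/(_ 1%E lte01) H0; apply: contrapT => /forallNP Minfty.
have : (1 <= hausdorff_delta (n%:R - alpha) 1 [set: 'rV[R]_n])%E.
  by apply: hausdorff_delta_setT_ge1; rewrite gerBl.
rewrite (_ : setT = [set x : 'rV[R]_n | frac_maximal alpha mu x = +oo%E]).
  by rewrite H0 leNgt lte01.
apply/esym/seteqP; split => // x _; have := Minfty x.
by rewrite ltey => /negP; rewrite negbK => /eqP.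
Qed.
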